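(* Let $(\mathcal{A},\mu,\alpha)$ be a Hom-Novikov algebra. Define a bilinear map $[\cdot,\cdot]:\mathcal{A}\times\mathcal{A}\to\mathcal{A}$ by $[x,y]=\mu(x,y)-\mu(y,x)$ for all $x,y\in\mathcal{A}$. Then $(\mathcal{A},[\cdot,\cdot],\alpha)$ is a Hom-Lie algebra (with the same twisting map $\alpha$).
   Context: All vector spaces are over a field $\mathbb{F}$ of characteristic zero. A Hom-Novikov algebra is a triple $(\mathcal{A},\mu,\alpha)$ consisting of a vector space $\mathcal{A}$, a bilinear map $\mu:\mathcal{A}\times\mathcal{A}\to\mathcal{A}$, $\mu(x,y)=xy$, and an algebra homomorphism $\alpha:\mathcal{A}\to\mathcal{A}$ (linear with $\alpha(xy)=\alpha(x)\alpha(y)$) such that for all $x,y,z\in\mathcal{A}$: $(xy)\alpha(z)=(xz)\alpha(y)$ and $(xy)\alpha(z)-\alpha(x)(yz)=(yx)\alpha(z)-\alpha(y)(xz)$. A Hom-Lie algebra is a triple $(L,[\cdot,\cdot],\alpha)$ with $L$ a vector space, $[\cdot,\cdot]:L\times L\to L$ bilinear and $\alpha:L\to L$ linear, such that $[x,y]=-[y,x]$ and $[[x,y],\alpha(z)]+[[z,x],\alpha(y)]+[[y,z],\alpha(x)]=0$ for all $x,y,z\in L$. *)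

(* Defs.v *)
From mathcomp Require Import all_boot all_order all_algebra.

Set Implicit Arguments.
Unset Strict Implicit.
Unset Printing Implicit Defensive.

Import GRing.Theory.
Local Open Scope ring_scope.

Record is_hom_novikov (F : fieldType) (A : lmodType F)
    (mu : A -> A -> A) (alpha : A -> A) : Prop := IsHomNovikov {
  hom_novikov_bilinear : bilinear_for *:%R *:%R mu;
  hom_novikov_linear : linear alpha;
  hom_novikov_mult : forall x y, alpha (mu x y) = mu (alpha x) (alpha y);
  hom_novikov_right_comm : forall x y z,
    mu (mu x y) (alpha z) = mu (mu x z) (alpha y);
  hom_novikov_left_sym : forall x y z,
    mu (mu x y) (alpha z) - mu (alpha x) (mu y z) =
    mu (mu y x) (alpha z) - mu (alpha y) (mu x z)
}.

Record is_hom_lie (F : fieldType) (L : lmodType F)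
    (br : L -> L -> L) (alpha : L -> L) : Prop := IsHomLie {
  hom_lie_bilinear : bilinear_for *:%R *:%R br;
  hom_lie_linear : linear alpha;
  hom_lie_skew : forall x y, br x y = - br y x;
  hom_lie_jacobi : forall x y z,
    br (br x y) (alpha z) + br (br z x) (alpha y) + br (br y z) (alpha x) = 0
}.

Definition commutator_bracket (V : zmodType) (mu : V -> V -> V) (x y : V) : V :=
  mu x y - mu y x.

(* Main.v *)
Require Import Defs.
From mathcomp Require Import all_boot all_order all_algebra.

Import GRing.Theory.
Local Open Scope ring_scope.

(** The Hom-Jacobi identity comes from left symmetry. Left symmetry says
    that the associator (x y) alpha(z) - alpha(x) (y z) is symmetric in x and y;
    equivalently, the left multiplications satisfy
    [x, y] alpha(z) = alpha(x) (y z) - alpha(y) (x z).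
    Substituting this into [[x, y], alpha(z)] = [x, y] alpha(z) - alpha(z) [x, y]
    removes every product of the form (u v) alpha(w). What remains is made of
    products alpha(u) (v w), and they split into two families, each of which is
    the difference between a term and its own cyclic rotation; so the cyclic sum
    telescopes to zero. Bilinearity and skew-symmetry are inherited formally
    from the shape mu(x, y) - mu(y, x). *)

Lemma telescope3 (V : zmodType) (a b c : V) : (a - b) + (b - c) + (c - a) = 0.
Proof. by rewrite !subrKA subrr. Qed.

Lemma commutator_bracket_skew (V : zmodType) (mu : V -> V -> V) (x y : V) :
  commutator_bracket mu x y = - commutator_bracket mu y x.
Proof. by rewrite /commutator_bracket opprB. Qed.

Lemma commutator_bracket_bilinear (F : fieldType) (A : lmodType F)
    (mu : A -> A -> A) :
  bilinear_for *:%R *:%R mu -> bilinear_for *:%R *:%R (commutator_bracket mu).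
Proof.
move=> [mul mur]; split=> z a x y; rewrite /commutator_bracket /=.
  by rewrite [mu (_ + _) z]mul [mu z _]mur /= scalerBr addrACA opprD.
by rewrite [mu z _]mur [mu (_ + _) z]mul /= scalerBr addrACA opprD.
Qed.

Section LeftSymmetric.

Variables (V : zmodType) (mu : V -> V -> V) (alpha : V -> V).

Hypothesis muBl : forall x y z, mu (x - y) z = mu x z - mu y z.
Hypothesis muBr : forall x y z, mu x (y - z) = mu x y - mu x z.
Hypothesis mu_left_sym : forall x y z,
  mu (mu x y) (alpha z) - mu (alpha x) (mu y z) =
  mu (mu y x) (alpha z) - mu (alpha y) (mu x z).

(** The terms are grouped so that the two terms inside each pair of parentheses
    differ by a cyclic permutation of x, y, z, and hence cancel in the cyclic sum
    of the Hom-Jacobi identity. *)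
Lemma commutator_bracket2E x y z :
  commutator_bracket mu (commutator_bracket mu x y) (alpha z) =
  (mu (alpha x) (mu y z) - mu (alpha z) (mu x y)) -
  (mu (alpha y) (mu x z) - mu (alpha z) (mu y x)).
Proof.
rewrite /commutator_bracket muBl muBr.
have -> : mu (mu x y) (alpha z) - mu (mu y x) (alpha z) =
          mu (alpha x) (mu y z) - mu (alpha y) (mu x z).
  rewrite -[mu (mu x y) _](subrK (mu (alpha x) (mu y z))) mu_left_sym.
  by rewrite addrAC [_ - _ - _]addrAC subrr sub0r addrC.
by rewrite !opprB addrACA [- _ + _]addrC addrACA.
Qed.

Lemma commutator_bracket_jacobi x y z :
  commutator_bracket mu (commutator_bracket mu x y) (alpha z) +
  commutator_bracket mu (commutator_bracket mu z x) (alpha y) +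
  commutator_bracket mu (commutator_bracket mu y z) (alpha x) = 0.
Proof.
rewrite !commutator_bracket2E [X in X + _]addrACA -opprD addrACA -opprD.
rewrite telescope3 sub0r.
by rewrite [_ + (mu (alpha x) _ - _)]addrC telescope3 oppr0.
Qed.

End LeftSymmetric.

Theorem corollary3p2 (F : fieldType) (charF0 : [pchar F]%R =i pred0)
    (A : lmodType F) (mu : A -> A -> A) (alpha : A -> A)
    (hA : is_hom_novikov mu alpha) :
  is_hom_lie (commutator_bracket mu) alpha.
Proof.
case: hA => mu_bilin alpha_lin _ _ mu_lsym; split=> //.
- exact: commutator_bracket_bilinear.
- exact: commutator_bracket_skew.
case: mu_bilin => mul mur; apply: commutator_bracket_jacobi => // x y z.
  by rewrite -[- y]scaleN1r addrC [LHS]mul /= scaleN1r addrC.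
by rewrite -[- z]scaleN1r addrC [LHS]mur /= scaleN1r addrC.
Qed.
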